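(* Let $(R,\mathfrak{m},k)$ be a Noetherian local ring with infinite residue field $k$. Let $I$ be a proper ideal of $R$ with analytic spread $d > 0$, and let $\mathfrak{a}$, $\mathfrak{b}$ be minimal reductions of $I$. Let $a_1, \dotsc, a_d$ be a minimal generating set of $\mathfrak{a}$. Then for almost all minimal generators $b$ of $\mathfrak{b}$, the ideal $(a_1, \dotsc, a_{d-1}, b)$ is a minimal reduction of $I$, in the following sense: there is a finite set of ideals $J_i$ of $R$ such that $\mathfrak{m}\mathfrak{b} \subseteq J_i$ for each $i$ and $\bigcup_i J_i \subsetneq \mathfrak{b}$, and such that for every $b \in \mathfrak{b}$, the ideal $(a_1,\dotsc,a_{d-1},b)$ is a minimal reduction of $I$ if and only if $b \notin \bigcup_i J_i$.
   Context: All rings are commutative with identity. An ideal $J$ is a reduction of an ideal $I$ if $J \subseteq I \subseteq \overline{J}$, where $\overline{J}$ is the integral closure of $J$ (in a Noetherian ring, equivalently $J \subseteq I$ and $J I^n = I^{n+1}$ for some $n \ge 0$). A minimal reduction of $I$ is a reduction of $I$ that is minimal with respect to inclusion among reductions of $I$. The fiber ring of $I$ is $\mathcal{F}(I) = \bigoplus_{n \geq 0} I^n/\mathfrak{m}I^n$ (with $I^0 = R$), and the analytic spread of $I$ is $\ell(I) := \dim \mathcal{F}(I)$ (Krull dimension). When $R$ is Noetherian local with infinite residue field, every minimal reduction of $I$ has minimal number of generators equal to $\ell(I)$. A minimal generator of $\mathfrak{b}$ is an element of $\mathfrak{b} \setminus \mathfrak{m}\mathfrak{b}$. *)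

(* Defs.v *)
From HB Require Import structures.
From mathcomp Require Import all_boot all_order all_algebra.
From mathcomp Require Import all_classical.

Set Implicit Arguments.
Unset Strict Implicit.
Unset Printing Implicit Defensive.

Import GRing.Theory.
Local Open Scope ring_scope.
Local Open Scope classical_set_scope.
Local Open Scope quotient_scope.

(* Ideals are sets closed under the module operations, so that the unit ideal
   is allowed; [idealr R] from ring_quotient only covers proper ideals and is
   used where quotient rings or prime ideals are needed. *)
Definition is_ideal (R : comNzRingType) (J : set R) : Prop :=
  [/\ J 0, forall x y, J x -> J y -> J (x + y)
         & forall r x, J x -> J (r * x)].

Definition ideal_gen (R : comNzRingType) (S : set R) : set R :=
  smallest (@is_ideal R) S.

Definition ideal_mul (R : comNzRingType) (I J : set R) : set R :=
  ideal_gen [set x * y | x in I & y in J].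

Definition ideal_exp (R : comNzRingType) (I : set R) (n : nat) : set R :=
  iter n (ideal_mul I) setT.

Definition noetherian (R : comNzRingType) : Prop :=
  forall J : set R, is_ideal J -> exists s : seq R, J = ideal_gen [set` s].

Definition is_maximal (R : comNzRingType) (m : idealr R) : Prop :=
  forall n : idealr R, {subset m <= n} -> n =i m.

Definition is_local (R : comNzRingType) (m : idealr R) : Prop :=
  is_maximal m /\ forall n : idealr R, is_maximal n -> n =i m.

Definition integral_over (R : comNzRingType) (J : set R) (x : R) : Prop :=
  exists (n : nat) (c : nat -> R),
    [/\ (0 < n)%N, forall i, (0 < i <= n)%N -> ideal_exp J i (c i)
      & x ^+ n + \sum_(1 <= i < n.+1) c i * x ^+ (n - i) = 0].

Definition integral_closure (R : comNzRingType) (J : set R) : set R :=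
  [set x | integral_over J x].

Definition is_reduction (R : comNzRingType) (I J : set R) : Prop :=
  [/\ is_ideal J, J `<=` I & I `<=` integral_closure J].

Definition is_minimal_reduction (R : comNzRingType) (I J : set R) : Prop :=
  is_reduction I J /\
  forall K : set R, is_reduction I K -> K `<=` J -> K = J.

Definition is_minimal_generating (R : comNzRingType) (n : nat)
    (a : 'I_n -> R) (A : set R) : Prop :=
  ideal_gen (range a) = A /\
  forall D : set 'I_n, ideal_gen (a @` D) = A -> D = setT.

Definition prime_chain (A : comNzRingType) (n : nat) : Prop :=
  exists P : 'I_n.+1 -> prime_idealr A,
    forall i j : 'I_n.+1, (i < j)%N -> [set` P i] `<` [set` P j].

Definition krull_dim_eq (A : comNzRingType) (n : nat) : Prop :=
  prime_chain A n /\ forall k : nat, prime_chain A k -> (k <= n)%N.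

Section IdealFacts.
Variable R : comNzRingType.
Implicit Types (I J S : set R).

Lemma ideal_gen_ideal S : is_ideal (ideal_gen S).
Proof.
split=> [A [[]]//|x y Sx Sy A AP|r x Sx A AP].
  by case: (AP) => -[_ + _] _; apply; [apply: Sx|apply: Sy].
by case: (AP) => -[_ _ +] _; apply; apply: Sx.
Qed.

Lemma ideal_exp_ideal I n : is_ideal (ideal_exp I n).
Proof. by case: n => [|n]; [split | apply: ideal_gen_ideal]. Qed.

Lemma ideal_mulP I J x y : I x -> J y -> ideal_mul I J (x * y).
Proof. by move=> Ix Jy; apply: sub_gen_smallest; exists x => //; exists y. Qed.

Lemma ideal_sum J : is_ideal J -> forall (n : nat) (f : 'I_n -> R),
  (forall i, J (f i)) -> J (\sum_(i < n) f i).
Proof. by case=> J0 JD _ n f Jf; apply: big_ind. Qed.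

Lemma ideal_expM I m n x y :
  ideal_exp I m x -> ideal_exp I n y -> ideal_exp I (m + n) (x * y).
Proof.
elim: m x => [|m IH] x Ix Iy.
  by case: (ideal_exp_ideal I n) => _ _; apply.
pose T := [set z | ideal_exp I (m + n).+1 (z * y)].
have [T0 TD TM] := ideal_exp_ideal I (m + n).+1.
apply: (Ix T); split.
  split; rewrite /T /=; first by rewrite mul0r.
    by move=> u v Tu Tv; rewrite mulrDl; apply: TD.
  by move=> r u Tu; rewrite -mulrA; apply: TM.
move=> _ [u Iu [v Iv <-]]; rewrite /T /= -mulrA.
by apply: ideal_mulP => //; apply: IH.
Qed.

Lemma ideal_mul_expM I J m n x y :
  ideal_exp I m x -> ideal_mul J (ideal_exp I n) y ->
  ideal_mul J (ideal_exp I (m + n)) (x * y).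
Proof.
move=> Ix Jy; have [T0 TD TM] := ideal_gen_ideal
  [set x * y | x in J & y in ideal_exp I (m + n)].
apply: (Jy [set z | ideal_mul J (ideal_exp I (m + n)) (x * z)]); split.
  split=> /=; first by rewrite mulr0.
    by move=> u v Tu Tv; rewrite mulrDr; apply: TD.
  by move=> r u Tu; rewrite mulrCA; apply: TM.
move=> _ [u Ju [v Iv <-]] /=; rewrite mulrCA.
by apply: ideal_mulP => //; apply: ideal_expM.
Qed.

End IdealFacts.

(* The Rees algebra (+)_n I^n, as the polynomials in R['X] whose coefficient
   of 'X^n lies in I^n. *)
Section Rees.
Variables (R : comNzRingType) (I : set R).

Definition rees_pred : {pred {poly R}} :=
  fun p => `[< forall n, ideal_exp I n p`_n >].

Lemma rees_subring : subring_closed rees_pred.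
Proof.
split=> [|p q /asboolP Ip /asboolP Iq|p q /asboolP Ip /asboolP Iq];
  apply/asboolP=> n.
- rewrite coef1; case: n => [|n] //=.
  by have [] := ideal_exp_ideal I n.+1.
- have [_ D M] := ideal_exp_ideal I n.
  by rewrite coefB -mulN1r; apply: D => //; apply: M.
- rewrite coefM; apply: ideal_sum => [|i]; first exact: ideal_exp_ideal.
  have := ideal_expM (Ip i) (Iq (n - i)%N).
  by rewrite subnKC // -ltnS.
Qed.

HB.instance Definition _ :=
  GRing.isSubringClosed.Build {poly R} rees_pred rees_subring.

Record rees : Type := Rees { rees_val : {poly R}; _ : rees_val \in rees_pred }.

HB.instance Definition _ := [isSub for rees_val].
HB.instance Definition _ := [Choice of rees by <:].
HB.instance Definition _ := [SubChoice_isSubComNzRing of rees by <:].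

End Rees.

(* The fiber ring (+)_n I^n / m I^n, as the quotient of the Rees algebra by
   its ideal (+)_n m I^n. *)
Section FiberRing.
Variables (R : comNzRingType) (m : idealr R) (I : set R).

Definition fiber_ideal : {pred rees I} :=
  fun p => `[< forall n, ideal_mul [set` m] (ideal_exp I n) (val p)`_n >].

Lemma fiber_ideal_closed : idealr_closed fiber_ideal.
Proof.
split.
- apply/asboolP=> n; rewrite raddf0 coef0.
  by have [] := ideal_gen_ideal
    [set x * y | x in [set` m] & y in ideal_exp I n].
- apply/negP => /asboolP /(_ 0%N); rewrite rmorph1 coef1 /= => m1.
  have : 1 \in m.
    apply: (m1 [set` m]); split.
      split=> /=; [exact: rpred0 | move=> x y; exact: rpredD |].
      by move=> r x; apply: idealMr.
    by move=> _ [u mu [v _ <-]] /=; rewrite mulrC; apply: idealMr.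
  by rewrite idealr1.
- move=> p u v /asboolP mu /asboolP mv; apply/asboolP => n.
  have [_ D _] := ideal_gen_ideal
    [set x * y | x in [set` m] & y in ideal_exp I n].
  rewrite rmorphD rmorphM coefD; apply: D; last exact: mv.
  rewrite coefM; apply: ideal_sum => [|i]; first exact: ideal_gen_ideal.
  have /asboolP Ip := valP p.
  have := ideal_mul_expM (Ip i) (mu (n - i)%N).
  by rewrite subnKC // -ltnS.
Qed.

HB.instance Definition _ :=
  isIdealr.Build (rees I) fiber_ideal fiber_ideal_closed.

Definition fiber_ring : comNzRingType := {ideal_quot fiber_ideal}.

End FiberRing.

Definition analytic_spread_eq (R : comNzRingType) (m : idealr R) (I : set R)
    (d : nat) : Prop :=
  krull_dim_eq (fiber_ring m I) d.

(* Main.v *)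
Require Import Defs.
From HB Require Import structures.
From mathcomp Require Import all_boot all_order all_algebra perm.
From mathcomp Require Import all_classical.
From mathcomp Require Import ring zify.

(* Say that J reduces I when I^(p+1) <= J I^p for some p; by Cayley-Hamilton this
   is equivalent to J being a reduction of I when J <= I, and by Nakayama J
   reduces I iff J + mI does.  Let Q = (a_1, ..., a_(d-1)) + mI.  The ideals J_i
   are the N cap b, where N runs over the ideals Q <= N <= I that are maximal
   among those that do not reduce I.  Adding b to Q gives a reduction iff b lies
   in no such N, and b is contained in none of them, so that the J_i do not
   cover b because k is infinite.

   There are finitely many N: modulo Q, multiplication by a_d identifies
   I^(n+1)/Q I^n with I^(n+2)/Q I^(n+1) for large n, and this k-space has finite
   length.  If N_0, N_1, ... were distinct, then any two of them would add up to
   a reduction, and the images of the products N_0 ... N_(j-1) would form a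
   strictly decreasing sequence in that space.

   Applying the same exchange repeatedly turns e generators of a reduction
   into e elements of the minimal reduction a that generate a reduction, hence
   generate a.  So no reduction has fewer than d generators, and a reduction
   with d generators is minimal. *)

Set Implicit Arguments.
Unset Strict Implicit.
Unset Printing Implicit Defensive.

Import GRing.Theory.
Local Open Scope ring_scope.
Local Open Scope classical_set_scope.
Local Open Scope quotient_scope.

(** * Ideals as a commutative semiring *)

Section IdealSemiring.
Variable R : comNzRingType.

(** Bundling makes sums and products of ideals, the unit ideal included, into a semiring, so that
    [ring], [exprD] and big operators apply to them. *)
Record ideal := Ideal { ideal_set :> R -> Prop; idealP : is_ideal ideal_set }.

HB.instance Definition _ := gen_eqMixin ideal.
HB.instance Definition _ := gen_choiceMixin ideal.

Implicit Types (I J K X : ideal) (x y z : R) (s : seq R).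

Lemma ideal0 I : I 0. Proof. by case: (idealP I). Qed.
Lemma idealD I x y : I x -> I y -> I (x + y).
Proof. by case: (idealP I) => _ + _; apply. Qed.
Lemma idealMl I r x : I x -> I (r * x).
Proof. by case: (idealP I) => _ _; apply. Qed.
Lemma idealN I x : I x -> I (- x).
Proof. by rewrite -mulN1r; apply: idealMl. Qed.
Lemma idealB I x y : I x -> I y -> I (x - y).
Proof. by move=> Ix Iy; apply: idealD => //; apply: idealN. Qed.

Lemma ideal_eq I J : I `<=` J -> J `<=` I -> I = J.
Proof.
case: I J => [I hI] [J hJ] /= IJ JI.
have E : I = J by apply/seteqP.
by subst J; congr Ideal; apply: Prop_irrelevance.
Qed.

(** The unit ideal: [ideal_exp setT 0] unfolds to [setT]. *)
Definition idealT := Ideal (ideal_exp_ideal setT 0).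

Lemma is_ideal_zero : is_ideal [set 0 : R].
Proof.
by split => // [_ _ -> ->|r _ ->] /=; rewrite ?addr0 ?mulr0.
Qed.
Definition ideal_zero := Ideal is_ideal_zero.

HB.instance Definition _ := isPointed.Build ideal ideal_zero.

Lemma is_ideal_add I J : is_ideal [set x + y | x in I & y in J].
Proof.
split.
- by exists 0; [exact: ideal0|exists 0; [exact: ideal0|rewrite addr0]].
- move=> _ _ [x Ix [y Jy <-]] [x' Ix' [y' Jy' <-]].
  by exists (x + x'); [exact: idealD|exists (y + y'); [exact: idealD|ring]].
- move=> r _ [x Ix [y Jy <-]].
  by exists (r * x); [exact: idealMl|exists (r * y); [exact: idealMl|ring]].
Qed.
Definition ideal_add I J := Ideal (is_ideal_add I J).

Definition gen (S : set R) := Ideal (ideal_gen_ideal S).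

Definition ideal_prod I J : ideal := gen [set x * y | x in I & y in J].

Lemma gen_sub (S : set R) J : S `<=` J -> gen S `<=` J.
Proof. by move=> SJ x; apply; split => //; exact: idealP. Qed.

Lemma sub_gen (S : set R) : S `<=` gen S.
Proof. exact: sub_gen_smallest. Qed.

Lemma is_ideal_colon I y : is_ideal [set x | I (x * y)].
Proof.
split => /= [|u v Iu Iv|r u Iu]; first by rewrite mul0r; exact: ideal0.
  by rewrite mulrDl; exact: idealD.
by rewrite -mulrA; exact: idealMl.
Qed.
Definition colon I y := Ideal (is_ideal_colon I y).

Lemma ideal_prod_sub I J K :
  (forall x y, I x -> J y -> K (x * y)) -> ideal_prod I J `<=` K.
Proof. by move=> H; apply: gen_sub => _ [x Ix [y Jy <-]]; exact: H. Qed.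

Lemma ideal_prod_in I J x y : I x -> J y -> ideal_prod I J (x * y).
Proof. by move=> Ix Jy; apply: sub_gen; exists x => //; exists y. Qed.

Lemma ideal_addA : associative ideal_add.
Proof.
move=> I J K; apply: ideal_eq => z.
  move=> [x Ix [_ [y Jy [t Kt <-]] <-]].
  exists (x + y); first by exists x => //; exists y.
  by exists t => //; rewrite addrA.
move=> [_ [x Ix [y Jy <-]] [t Kt <-]].
exists x => //; exists (y + t); last by rewrite addrA.
by exists y => //; exists t.
Qed.

Lemma ideal_addC : commutative ideal_add.
Proof.
move=> I J; apply: ideal_eq => z [x Ix [y Jy <-]];
  by exists y => //; exists x => //; rewrite addrC.
Qed.

Lemma ideal_add0 : left_id ideal_zero ideal_add.
Proof.
move=> I; apply: ideal_eq => [_ [_ -> [y Iy <-]]|y Iy]; first by rewrite add0r.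
by exists 0 => //; exists y => //; rewrite add0r.
Qed.

HB.instance Definition _ :=
  GRing.isNmodule.Build ideal ideal_addA ideal_addC ideal_add0.

Lemma addI_in I J x y : I x -> J y -> (I + J)%R (x + y).
Proof. by move=> Ix Jy; exists x => //; exists y. Qed.

Lemma addI_sub I J K : I `<=` K -> J `<=` K -> I + J `<=` K.
Proof. by move=> IK JK _ [x Ix [y Jy <-]]; apply: idealD; auto. Qed.

Lemma sub_addl I J : I `<=` I + J.
Proof. by move=> x Ix; rewrite -[x]addr0; apply: addI_in (ideal0 _). Qed.

Lemma sub_addr I J : J `<=` I + J.
Proof. by move=> x Jx; rewrite -[x]add0r; apply: addI_in (ideal0 _) _. Qed.

Lemma addI_mono I J I' J' : I `<=` I' -> J `<=` J' -> I + J `<=` I' + J'.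
Proof.
move=> HI HJ; apply: addI_sub; first exact: subset_trans HI (@sub_addl _ _).
exact: subset_trans HJ (@sub_addr _ _).
Qed.

Lemma ideal_prodC : commutative ideal_prod.
Proof.
move=> I J; apply: ideal_eq; apply: ideal_prod_sub => x y Ix Jy;
  by rewrite mulrC; apply: ideal_prod_in.
Qed.

Lemma ideal_prodA : associative ideal_prod.
Proof.
have H I J K : ideal_prod I (ideal_prod J K) `<=`
               ideal_prod (ideal_prod I J) K.
  apply: ideal_prod_sub => x z Ix; rewrite mulrC.
  have: ideal_prod J K `<=` colon (ideal_prod (ideal_prod I J) K) x;
    last exact.
  apply: ideal_prod_sub => u v Ju Kv.
  suff: ideal_prod (ideal_prod I J) K (x * u * v) by rewrite -mulrA mulrC.
  by apply: ideal_prod_in => //; apply: ideal_prod_in.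
move=> I J K; apply: ideal_eq; first exact: H.
rewrite (ideal_prodC (ideal_prod I J)) (ideal_prodC I J).
by rewrite (ideal_prodC I (ideal_prod J K)) (ideal_prodC J K); exact: H.
Qed.

Lemma ideal_prod1 : left_id idealT ideal_prod.
Proof.
move=> I; apply: ideal_eq => [|x Ix].
  by apply: ideal_prod_sub => x y _ Iy; exact: idealMl.
by rewrite -[x]mul1r; apply: ideal_prod_in.
Qed.

Lemma ideal_prod0 : left_zero ideal_zero ideal_prod.
Proof.
move=> I; apply: ideal_eq => [|_ ->]; last exact: ideal0.
by apply: ideal_prod_sub => _ y -> _ /=; rewrite mul0r.
Qed.

Lemma ideal_prodDl : left_distributive ideal_prod +%R.
Proof.
move=> I J K; apply: ideal_eq.
  apply: ideal_prod_sub => _ z [x Ix [y Jy <-]] Kz.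
  exists (x * z); first exact: ideal_prod_in.
  by exists (y * z); [exact: ideal_prod_in|rewrite mulrDl].
by apply: addI_sub; apply: ideal_prod_sub => x z Hx Kz; apply: ideal_prod_in;
  rewrite //; [exact: sub_addl|exact: sub_addr].
Qed.

HB.instance Definition _ := GRing.Nmodule_isComPzSemiRing.Build ideal
  ideal_prodA ideal_prodC ideal_prod1 ideal_prodDl ideal_prod0.

Lemma mulI_in I J x y : I x -> J y -> (I * J)%R (x * y).
Proof. exact: ideal_prod_in. Qed.

Lemma mulI_sub I J K :
  (forall x y, I x -> J y -> K (x * y)) -> I * J `<=` K.
Proof. exact: ideal_prod_sub. Qed.

Lemma mulI_mono I J I' J' : I `<=` I' -> J `<=` J' -> I * J `<=` I' * J'.
Proof. by move=> HI HJ; apply: mulI_sub => x y Ix Jy; apply: mulI_in; auto. Qed.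

Lemma mulI_subr I J : I * J `<=` J.
Proof. by apply: mulI_sub => x y _; exact: idealMl. Qed.

Lemma expI_in I n x : I x -> (I ^+ n)%R (x ^+ n).
Proof.
move=> Ix; elim: n => [|n IH]; first by rewrite expr0.
by rewrite !exprS; apply: mulI_in.
Qed.

Lemma expI_mono I J n : I `<=` J -> I ^+ n `<=` J ^+ n.
Proof.
move=> IJ; elim: n => [|n IH]; first by rewrite !expr0.
by rewrite !exprS; apply: mulI_mono.
Qed.

Lemma expI_eq I n : ideal_exp I n = I ^+ n :> set R.
Proof.
elim: n => [|n IH]; first by rewrite expr0.
by rewrite exprS -[ideal_exp I n.+1]/(ideal_mul I (ideal_exp I n)) IH.
Qed.

Definition pid x := gen [set x].

Lemma pidP x y : pid x y <-> exists r, y = r * x.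
Proof.
split=> [|[r ->]]; last by apply: idealMl; apply: sub_gen.
have Ix : is_ideal [set y | exists r, y = r * x].
  split=> /= [|_ _ [r ->] [r' ->]|r _ [r' ->]].
  - by exists 0; rewrite mul0r.
  - by exists (r + r'); rewrite mulrDl.
  - by exists (r * r'); rewrite mulrA.
apply: (@gen_sub _ (Ideal Ix)) => _ ->.
by exists 1; rewrite mul1r.
Qed.

Lemma pid_id x : pid x x. Proof. exact: sub_gen. Qed.

Lemma pid_sub x J : J x -> pid x `<=` J.
Proof. by move=> Jx; apply: gen_sub => _ ->. Qed.

Lemma mul_pidP x J y : (pid x * J)%R y <-> exists2 z, J z & y = x * z.
Proof.
split=> [|[z Jz ->]]; last by apply: mulI_in => //; exact: pid_id.
have Ix : is_ideal [set y | exists2 z, J z & y = x * z].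
  split=> /= [|_ _ [z Jz ->] [z' Jz' ->]|r _ [z Jz ->]].
  - by exists 0; [exact: ideal0|rewrite mulr0].
  - by exists (z + z'); [exact: idealD|rewrite mulrDr].
  - by exists (r * z); [exact: idealMl|rewrite mulrCA].
apply: (@mulI_sub _ _ (Ideal Ix)) => _ z /pidP[r ->] Jz.
by exists (r * z); [exact: idealMl|rewrite mulrAC mulrC].
Qed.

Lemma pid_mul x y : pid (x * y) = pid x * pid y.
Proof.
apply: ideal_eq; first by apply: pid_sub; apply: mulI_in; exact: pid_id.
apply: mulI_sub => _ _ /pidP[r ->] /pidP[t ->].
by apply/pidP; exists (r * t); ring.
Qed.

Lemma pid_exp x n : pid (x ^+ n) = pid x ^+ n.
Proof.
elim: n => [|n IH].
  rewrite !expr0; apply: ideal_eq => // y _.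
  by apply/pidP; exists y; rewrite mulr1.
by rewrite !exprS pid_mul IH.
Qed.

Definition ispan s : ideal := \sum_(x <- s) pid x.

Lemma ispan_nil : ispan [::] = 0. Proof. by rewrite /ispan big_nil. Qed.
Lemma ispan_cons x s : ispan (x :: s) = pid x + ispan s.
Proof. by rewrite /ispan big_cons. Qed.

Lemma ispan_sub s J : (forall x, x \in s -> J x) -> ispan s `<=` J.
Proof.
elim: s => [|x s IH] H; first by rewrite ispan_nil => _ ->; exact: ideal0.
rewrite ispan_cons; apply: addI_sub.
  by apply: pid_sub; apply: H; rewrite mem_head.
by apply: IH => y ys; apply: H; rewrite inE ys orbT.
Qed.

Lemma mem_ispan s x : x \in s -> ispan s x.
Proof.
elim: s => [//|y s IH]; rewrite inE ispan_cons => /predU1P[->|/IH sx].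
  by apply: sub_addl; exact: pid_id.
exact: sub_addr.
Qed.

Lemma ispanE s : gen [set` s] = ispan s.
Proof.
apply: ideal_eq; first by apply: gen_sub => x; exact: mem_ispan.
by apply: ispan_sub => x xs; apply: sub_gen.
Qed.

Definition cap I J : ideal.
Proof.
exists (I `&` J); split => [|x y [Ix Jx] [Iy Jy]|r x [Ix Jx]].
- by split; exact: ideal0.
- by split; exact: idealD.
- by split; exact: idealMl.
Defined.

End IdealSemiring.

Arguments pid_id {R} x.
Arguments sub_addl {R} I J [t] _.
Arguments sub_addr {R} I J [t] _.
Arguments mulI_subr {R} I J [t] _.

(** * Chain conditions in a Noetherian ring *)

Section Noetherian.
Variable R : comNzRingType.
Hypothesis R_noetherian : noetherian R.
Implicit Types (I J K : ideal R) (x y z : R) (s : seq R).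

Lemma ideal_fg I : exists s, I = ispan s.
Proof.
have [s Is] := R_noetherian (idealP I).
exists s; rewrite -ispanE.
by apply: ideal_eq => x; rewrite /= -Is.
Qed.

Lemma chain_leq (f : nat -> ideal R) i j :
  (forall n, f n `<=` f n.+1) -> (i <= j)%N -> f i `<=` f j.
Proof.
move=> fS /subnK <-; elim: (j - i)%N => [//|k IH].
by rewrite addSn; apply: subset_trans IH (fS _).
Qed.

Lemma is_ideal_bigcup (f : nat -> ideal R) :
  (forall n, f n `<=` f n.+1) -> is_ideal (\bigcup_n f n).
Proof.
move=> fS.
have fle i j := chain_leq (i := i) (j := j) fS.
split => [|x y [i _ fx] [j _ fy]|r x [i _ fx]].
- by exists 0%N => //; exact: ideal0.
- exists (maxn i j) => //; apply: idealD.
    by apply: fle fx; exact: leq_maxl.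
  by apply: fle fy; exact: leq_maxr.
- by exists i => //; exact: idealMl.
Qed.

(** The union of the chain is finitely generated, and its generators all lie in one term. *)
Lemma ideal_chain (f : nat -> ideal R) :
  (forall n, f n `<=` f n.+1) -> exists n, forall k, f k `<=` f n.
Proof.
move=> fS.
have fle i j := chain_leq (i := i) (j := j) fS.
pose U := Ideal (is_ideal_bigcup fS); have [s Us] := ideal_fg U.
have [n sn] : exists n, forall x, x \in s -> f n x.
  have : forall x, x \in s -> U x by move=> x xs; rewrite Us; exact: mem_ispan.
  elim: (s) => [_|x s' IH H]; first by exists 0%N.
  have [n Hn] : exists n, forall x, x \in s' -> f n x.
    by apply: IH => y ys; apply: H; rewrite inE ys orbT.
  have [p _ px] := H x (mem_head _ _).
  exists (maxn n p) => y; rewrite inE => /predU1P[->|/Hn fy].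
    by apply: fle px; exact: leq_maxr.
  by apply: fle fy; exact: leq_maxl.
exists n => k x fx; apply: (@ispan_sub _ s) => //.
by rewrite -Us; exists k.
Qed.

(** If no such maximal ideal existed, choice would iterate strict enlargements of [I] within [P]
    into a chain that never stabilizes. *)
Lemma ideal_maximal (P : ideal R -> Prop) I : P I ->
  exists J, [/\ P J, I `<=` J & forall K, P K -> J `<=` K -> K = J].
Proof.
move=> PI; apply: contrapT => nJ.
pose T := {J : ideal R | P J /\ I `<=` J}.
have next (J : T) : exists K : T, sval J `<=` sval K /\ ~ sval K `<=` sval J.
  apply: contrapT => nK; apply: nJ; exists (sval J).
  case: J nK => J [PJ IJ] /= nK; split => // K PK JK.
  apply: contrapT => KJ; apply: nK.
  exists (exist _ K (conj PK (subset_trans IJ JK))) => /=; split => //.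
  by move=> KJ'; apply: KJ; exact: ideal_eq.
have [g gP] := choice next.
pose f n := iter n g (exist _ I (conj PI (@subset_refl _ I))).
have [n fn] := @ideal_chain (fun n => sval (f n)) (fun n => (gP (f n)).1).
exact: (gP (f n)).2 (fn n.+1).
Qed.

End Noetherian.

(** * Units of a local ring and Nakayama's lemma *)

Definition of_idealr (R : comNzRingType) (m : idealr R) : ideal R.
Proof.
exists [set` m]; split => /= [|x y|r x].
- exact: rpred0.
- exact: rpredD.
- exact: idealMr.
Defined.

Section Local.
Variables (R : comNzRingType) (m : idealr R).
Hypotheses (R_noetherian : noetherian R) (R_local : is_local m).
Implicit Types (I J K X Y : ideal R) (x y z : R) (s : seq R).
Let mm := of_idealr m.

Lemma idealr_of_proper J : ~ J 1 ->
  exists n : idealr R, forall x, (x \in n) = `[<J x>].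
Proof.
move=> J1; pose p : {pred R} := fun x => `[<J x>].
have cl : idealr_closed p.
  split; first by apply/asboolP; exact: ideal0.
    by apply/negP => /asboolP.
  move=> a u v /asboolP Ju /asboolP Jv; apply/asboolP.
  by apply: idealD => //; apply: idealMl.
pose q : idealr R := HB.pack_for (idealr R) p (isIdealr.Build R p cl).
by exists q.
Qed.

(** A nonunit lies in an ideal that is maximal among the proper ones, and locality identifies that
    ideal with [m]. *)
Lemma local_unit x : x \notin m -> exists y, y * x = 1.
Proof.
move=> xm; apply: contrapT => nx.
have x1 : ~ pid x 1 by move=> /pidP[r r1]; apply: nx; exists r.
have [J [J1 xJ Jmax]] :=
  ideal_maximal R_noetherian (P := fun J => ~ J 1) x1.
have [n nJ] := idealr_of_proper J1.
have n_max : is_maximal n.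
  move=> n' nn' y; apply/idP/idP => [n'y|]; last exact: nn'.
  have n'E : of_idealr n' = J.
    apply: Jmax => [/=|z Jz /=]; first by rewrite idealr1.
    by apply: nn'; rewrite nJ; apply/asboolP.
  by rewrite nJ; apply/asboolP; rewrite -n'E.
case: R_local => _ /(_ _ n_max) nm.
move: xm; rewrite -nm nJ => /asboolP; apply; apply: xJ; exact: pid_id.
Qed.

(** Keeping [Y] arbitrary avoids quotient modules. The generators are eliminated one by one: the
    hypothesis gives g = y + w + g t with t in m, and 1 - t is a unit, so that g lies in
    [Y + mm * ispan s] for the remaining [s]. *)
Lemma nakayama s Y : ispan s `<=` Y + mm * ispan s -> ispan s `<=` Y.
Proof.
elim: s => [|g s IH]; first by rewrite ispan_nil => _ _ ->; exact: ideal0.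
rewrite ispan_cons => H.
have gY : (Y + mm * ispan s)%R g.
  have [y Yy [z]] := H g (sub_addl _ _ (pid_id g)).
  rewrite mulrDr => -[v gv [w sw vw]] yg.
  have [t mt tE] : exists2 t, mm t & g * t = g - (y + w).
    move: gv; rewrite mulrC => /mul_pidP[t mt zt]; exists t => //.
    by rewrite -zt -yg -vw; ring.
  have [|u u1] := @local_unit (1 - t).
    apply/negP => m1; suff : 1 \in m by rewrite idealr1.
    by rewrite -[1](subrK t); apply: rpredD.
  have -> : g = u * (y + w).
    rewrite -[g in LHS]mul1r -u1 -mulrA mulrC mulrBl mul1r [t * g]mulrC tE.
    by ring.
  by apply: idealMl; apply: addI_in.
have sY : ispan s `<=` Y.
  apply: IH; apply: subset_trans (sub_addr (pid g) _) _.
  apply: subset_trans H _; rewrite mulrDr.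
  apply: addI_sub; first exact: sub_addl.
  apply: addI_sub; last exact: sub_addr.
  apply: subset_trans (pid_sub gY).
  exact: mulI_subr.
apply: addI_sub => //; apply: pid_sub.
apply: (addI_sub _ _ gY) => //.
by apply: subset_trans sY; exact: mulI_subr.
Qed.

Lemma nakayama_fg X Y : X `<=` Y + mm * X -> X `<=` Y.
Proof. by have [s ->] := ideal_fg R_noetherian X; exact: nakayama. Qed.

End Local.

(** * Dimension over the residue field, and avoidance of finitely many ideals *)

Section Rank.
Variables (R : comNzRingType) (m : idealr R).
Hypotheses (R_noetherian : noetherian R) (R_local : is_local m).
Implicit Types (I J B U E Y : ideal R) (x y z : R) (s : seq R).
Let mm := of_idealr m.

(** [rho E] plays the role of the k-dimension of E/U: (U + [ispan s])/U is a k-space spanned by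
    [size s] elements. Adding a generator x enlarges Y = U + [ispan s] by at most one dimension, so
    the new rank is the rank of the trace of E on Y, plus 1 if E is not inside Y. *)
Lemma ideal_rank U s : mm * ispan s `<=` U ->
  exists rho : ideal R -> nat, (forall E, (rho E <= size s)%N) /\
    forall E E', U `<=` E -> E `<=` E' -> E' `<=` U + ispan s ->
      ~ E' `<=` E -> (rho E < rho E')%N.
Proof.
elim: s => [_|x s IH mU].
  exists (fun=> 0%N); split => // E E' UE _ E'U; case.
  by apply: subset_trans UE; rewrite ispan_nil addr0 in E'U.
rewrite ispan_cons mulrDr in mU.
have [rho [rho_le rho_lt]] := IH (subset_trans (sub_addr _ _) mU).
pose Y := U + ispan s.
exists (fun E => rho (cap E Y) + `[< ~ E `<=` Y >])%N; split => [E|E E' UE EE'].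
  by rewrite /= -addn1 leq_add ?rho_le ?leq_b1.
move=> E'X E'E.
have bool_le : (`[< ~ E `<=` Y >] <= `[< ~ E' `<=` Y >])%N.
  case: asboolP => // EY; case: asboolP => // E'Y; exfalso.
  by apply: E'Y => E'Y; apply: EY; apply: subset_trans E'Y.
have [EE'Y|nEE'Y] := pselect (cap E' Y `<=` cap E Y); last first.
  suff : (rho (cap E Y) < rho (cap E' Y))%N by lia.
  apply: rho_lt => //.
  - by move=> u Uu; split; [exact: UE|exact: sub_addl].
  - by move=> u [/EE' Eu Yu].
  - by move=> u [].
have cE : cap E Y = cap E' Y.
  by apply: ideal_eq => // u [/EE' Eu Yu].
rewrite cE ltn_add2l.
have nE'Y : ~ E' `<=` Y.
  by move=> E'Y; apply: E'E => u E'u; have [] := EE'Y u (conj E'u (E'Y _ E'u)).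
suff EY : E `<=` Y by case: asboolP => //; case: asboolP.
(* Here E and E' have the same trace on Y and both leave Y. An element w of E outside Y has a unit
   as its coefficient of x, since m x <= U; subtracting a multiple of w from z therefore lands in Y,
   hence in E. *)
apply: contrapT => nEY; apply: E'E => z E'z.
have [w [Ew nYw]] : exists w, E w /\ ~ Y w.
  apply: contrapT => H; apply: nEY => w Ew; apply: contrapT => Yw.
  by apply: H; exists w.
have dec v : E' v -> exists r y, Y y /\ v = r * x + y.
  move=> /E'X; rewrite ispan_cons addrCA => -[_ /pidP[r ->] [y Yy <-]].
  by exists r, y.
have [r [y [Yy wE]]] := dec w (EE' _ Ew).
have [r' [y' [Yy' zE]]] := dec z E'z.
have [|u u1] := local_unit R_noetherian R_local (x := r).
  apply/negP => mr; apply: nYw; rewrite wE; apply: idealD => //.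
  apply: sub_addl; apply: mU; apply: sub_addl; apply: mulI_in => //.
  exact: pid_id.
have Ezw : E (z - r' * u * w).
  have := EE'Y (z - r' * u * w); case => //; split.
    by apply: idealB => //; apply: idealMl; exact: EE'.
  have -> : z - r' * u * w = y' - r' * u * y.
    rewrite zE wE.
    have -> : r' * u * (r * x + y) = r' * (u * r) * x + r' * u * y by ring.
    by rewrite u1; ring.
  by apply: idealB => //; apply: idealMl.
by rewrite -[z](subrK (r' * u * w)); apply: idealD => //; apply: idealMl.
Qed.

Hypothesis k_infinite : infinite_set [set: {ideal_quot m}].

(** As for a vector space over an infinite field, which is no finite union of proper subspaces. If b
    avoids [l] but lies in K, take y in B outside K: no y + r b lies in K, and each member of [l]
    excludes at most one residue class of r. *)
Lemma ideal_avoid B (l : seq (ideal R)) :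
  (forall J, J \in l -> ~ B `<=` J) ->
  exists2 b, B b & forall J, J \in l -> ~ J b.
Proof.
elim: l => [_|K l IH H]; first by exists 0; [exact: ideal0|].
have [|b Bb bl] := IH; first by move=> J Jl; apply: H; rewrite inE Jl orbT.
have [Kb|nKb] := pselect (K b); last first.
  by exists b => // J; rewrite inE => /predU1P[->|/bl].
have [y [By nKy]] : exists y, B y /\ ~ K y.
  apply: contrapT => nK; apply: (H K); first exact: mem_head.
  by move=> y By; apply: contrapT => Ky; apply: nK; exists y.
(* The residue classes that J excludes. Two distinct ones would put a unit multiple of b, hence b
   itself, into J. *)
pose bad (J : ideal R) : set {ideal_quot m} :=
  [set t | exists2 r, \pi_{ideal_quot m} r = t & J (y + r * b)].
have bad1 J : ~ J b -> finite_set (bad J).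
  move=> nJb; have [[t0 [r0 t0E Jr0]]|nbad] := pselect (exists t, bad J t);
    last first.
    by apply: (@sub_finite_set _ _ set0) => // t bt; apply: nbad; exists t.
  apply: (@sub_finite_set _ _ [set t0]) => // t [r tE Jr] /=.
  rewrite -tE -t0E; apply/eqP; rewrite -Quotient.idealrBE.
  apply: contrapT => /negP /(local_unit R_noetherian R_local)[u u1].
  apply: nJb; rewrite -[b]mul1r -u1 -mulrA; apply: idealMl.
  have -> : (r - r0) * b = (y + r * b) - (y + r0 * b) by ring.
  exact: idealB.
have fin : finite_set [set t | exists2 J, J \in l & bad J t].
  elim: (l) bl => [_|J l' IH' bl].
    by apply: (@sub_finite_set _ _ set0) => // t [].
  apply: (@sub_finite_set _ _
    (bad J `|` [set t | exists2 J, J \in l' & bad J t])).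
    by move=> t [J']; rewrite inE => /predU1P[->|Jl]; [left|right; exists J'].
  rewrite finite_setU; split; first by apply: bad1; apply: bl; exact: mem_head.
  by apply: IH' => J' Jl; apply: bl; rewrite inE Jl orbT.
have [t nt] : exists t, ~ [set t | exists2 J, J \in l & bad J t] t.
  apply: contrapT => nt; apply: k_infinite.
  apply: sub_finite_set fin => t _.
  by apply: contrapT => Ht; apply: nt; exists t.
exists (y + repr t * b); first by apply: idealD => //; apply: idealMl.
move=> J; rewrite inE => /predU1P[-> Ky|Jl Jy].
  apply: nKy; rewrite -[y](addrK (repr t * b)).
  by apply: idealB => //; apply: idealMl.
by apply: nt; exists J => //; exists (repr t) => //; rewrite reprK.
Qed.

End Rank.

(** * Finiteness of the set of maximal non-reducing ideals *)

Section NonReductions.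
Variables (R : comNzRingType) (m : idealr R).
Hypotheses (R_noetherian : noetherian R) (R_local : is_local m).
Implicit Types (I J N Q : ideal R) (x y z w : R) (s : seq R).
Let mm := of_idealr m.

Definition pow_red I N := exists p, I ^+ p.+1 `<=` N * I ^+ p.

Lemma pow_red_mono I N N' : N `<=` N' -> pow_red I N -> pow_red I N'.
Proof.
by move=> NN' [p Hp]; exists p; apply: subset_trans Hp _; apply: mulI_mono.
Qed.

Lemma pow_red_leq I N p q : (p <= q)%N ->
  I ^+ p.+1 `<=` N * I ^+ p -> I ^+ q.+1 `<=` N * I ^+ q.
Proof.
move=> /subnKC <- Hp; rewrite -addSn !exprD mulrA.
exact: mulI_mono.
Qed.

(** Nakayama applies to I^(p+1), because (N + mI) I^p = N I^p + m I^(p+1). *)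
Lemma pow_red_mulm I N : pow_red I (N + mm * I) -> pow_red I N.
Proof.
move=> [p Hp]; exists p; apply: (nakayama_fg R_noetherian R_local).
by apply: subset_trans Hp _; rewrite mulrDl exprS mulrA.
Qed.

Section Multiplication.
Variables (I Q : ideal R) (c : R).
Hypotheses (QI : Q `<=` I) (Ic : I c) (Qc_red : pow_red I (Q + pid c)).

(** Expanding I^(p+1) <= Q I^p + c I^p repeatedly shows that multiplication by c^j is onto from
    I^(n0+1) to I^(n0+j+1) modulo Q I^(n0+j). *)
Lemma pow_sub_c n0 j : I ^+ n0.+1 `<=` (Q + pid c) * I ^+ n0 ->
  I ^+ (n0 + j).+1 `<=` pid c ^+ j * I ^+ n0.+1 + Q * I ^+ (n0 + j).
Proof.
move=> H0; elim: j => [|j IH].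
  by rewrite expr0 mul1r addn0; exact: sub_addl.
have Hj := @pow_red_leq _ _ n0 (n0 + j).+1 ltac:(lia) H0.
rewrite addnS; apply: subset_trans Hj _; rewrite mulrDl.
apply: addI_sub; first exact: sub_addr.
apply: subset_trans (mulI_mono (@subset_refl _ (pid c)) IH) _.
rewrite mulrDr mulrA -exprS; apply: addI_mono => //.
rewrite mulrCA exprS; apply: mulI_mono => //.
by apply: mulI_mono => //; exact: pid_sub.
Qed.

(** The kernels [K j] of multiplication by c^j from I^(n0+1) to I^(n0+j+1)/Q I^(n0+j) ascend and so
    stabilize. By surjectivity an element killed by c is c^j w0 modulo Q I^(n0+j), with w0 in
    [K j.+1]; once the kernels are stable, w0 lies in [K j] and the element is zero. *)
Lemma mulc_injective : exists n,
  [/\ I ^+ n.+1 `<=` (Q + pid c) * I ^+ n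
    & forall p, (n <= p)%N -> forall w,
      (I ^+ p.+1)%R w -> (Q * I ^+ p.+1)%R (c * w) -> (Q * I ^+ p)%R w].
Proof.
have [n0 H0] := Qc_red.
pose K j := cap (I ^+ n0.+1) (colon (Q * I ^+ (n0 + j)) (c ^+ j)).
have KS j : K j `<=` K j.+1.
  move=> w [Iw Kw]; split => //.
  suff: (Q * I ^+ (n0 + j).+1)%R (c * (w * c ^+ j)).
    by rewrite mulrCA -exprS addnS.
  rewrite exprS mulrCA; exact: mulI_in.
have [j0 Kj0] := ideal_chain R_noetherian KS.
exists (n0 + j0)%N; split; first by apply: pow_red_leq H0; lia.
move=> p; move=> /subnKC <-; move: (p - _)%N => i w Iw cw.
rewrite -addnA in Iw cw *; set j := (j0 + i)%N in Iw cw *.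
have [v] := @pow_sub_c n0 j H0 w Iw.
rewrite -pid_exp => /mul_pidP[w0 Iw0 ->] [l Ll wE].
suff : K j0 w0.
  move=> Kw0; have [_ Kjw0] : K j w0.
    by rewrite /j; elim: (i) => [|i' IH]; rewrite ?addn0 // addnS; exact: KS.
  by rewrite -wE; apply: idealD => //; rewrite [c ^+ j * _]mulrC.
apply: (Kj0 j.+1); split => //.
suff: (Q * I ^+ (n0 + j).+1)%R (w0 * c ^+ j.+1) by rewrite -addnS.
have -> : w0 * c ^+ j.+1 = c * w - c * l by rewrite -wE exprS; ring.
apply: idealB => //; rewrite exprS mulrCA; exact: mulI_in.
Qed.
Hypothesis mIQ : mm * I `<=` Q.

Lemma prod_sub_pow (N : nat -> ideal R) j :
  (forall i, N i `<=` I) -> \prod_(i < j) N i `<=` I ^+ j.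
Proof.
move=> NI; elim: j => [|j IH]; first by rewrite big_ord0 expr0.
by rewrite big_ord_recr exprSr; apply: mulI_mono.
Qed.

(** As for comaximal ideals: in the product of the relations I^(p+1) <= (N_i + M) I^p, every term
    with a factor M goes to the second summand. The bound [n <= q] lets the exponent reach the range
    where multiplication by c is well behaved. *)
Lemma comaximal_prod (N : nat -> ideal R) (M : ideal R) n j :
  (forall i, N i `<=` I) -> (forall i, (i < j)%N -> pow_red I (N i + M)) ->
  exists2 q, (n <= q)%N &
    I ^+ (q + j).+1 `<=` \prod_(i < j) N i * I ^+ q.+1 + M * I ^+ (q + j).
Proof.
move=> NI; elim: j => [_|j IH Nred].
  by exists n; rewrite // big_ord0 mul1r addn0; exact: sub_addl.
have [|q nq Hq] := IH; first by move=> i ij; apply: Nred; exact: ltnW.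
have [p Hp] := Nred j (ltnSn j).
exists (q + p)%N; first exact: leq_trans (leq_addr _ _).
have -> : (q + p + j.+1).+1 = ((q + j).+1 + p.+1)%N by lia.
have PS : \prod_(i < j.+1) N i = \prod_(i < j) N i * N j.
  by rewrite big_ord_recr.
rewrite exprD PS; have := prod_sub_pow (j := j) NI.
set P := \prod_(_ < j) _ in Hq * => PI.
apply: subset_trans (mulI_mono Hq (@subset_refl _ _)) _.
rewrite mulrDl. apply: addI_sub; last first.
  rewrite -mulrA -exprD; apply: subset_trans (sub_addr _ _).
  by have -> : (q + j + p.+1 = q + p + j.+1)%N by lia.
apply: subset_trans (mulI_mono (@subset_refl _ _) Hp) _.
have -> : P * I ^+ q.+1 * ((N j + M) * I ^+ p) =
    P * N j * I ^+ (q + p).+1 + M * (P * I ^+ (q + p).+1).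
  by rewrite !exprS !exprD; ring.
apply: addI_mono => //; apply: mulI_mono => //.
have -> : (q + p + j.+1 = j + (q + p).+1)%N by lia.
by rewrite exprD; apply: mulI_mono.
Qed.

Lemma comaximal_nonred_absurd (N : nat -> ideal R) :
  (forall i, Q `<=` N i) -> (forall i, N i `<=` I) ->
  (forall i, ~ pow_red I (N i)) ->
  (forall i j, (i < j)%N -> pow_red I (N i + N j)) -> False.
Proof.
move=> QN NI N_nonred N_comax.
have [n [Hn c_inj]] := mulc_injective.
have c_surj p : (n <= p)%N -> I ^+ p.+1 `<=` (Q + pid c) * I ^+ p.
  by move=> np; apply: pow_red_leq Hn.
pose P j := \prod_(i < j) N i.
have PI j : P j `<=` I ^+ j by exact: prod_sub_pow.
have PS j : P j.+1 = P j * N j by rewrite /P big_ord_recr.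
(* [X j] represents the image of N_0 ... N_(j-1) I^(n+1) in I^(n+j+1)/Q I^(n+j), and [D j] is its
   pullback along c^j. All [D j] thus lie in the single quotient I^(n+1)/Q I^n, where they can be
   compared. *)
pose X j := P j * I ^+ n.+1 + Q * I ^+ (n + j).
pose D j := cap (I ^+ n.+1) (colon (X j) (c ^+ j)).
have XS j : X j.+1 `<=` pid c * (P j * I ^+ n.+1) + Q * I ^+ (n + j).+1.
  apply: addI_sub; last by rewrite addnS; exact: sub_addr.
  rewrite PS -mulrA.
  apply: subset_trans (mulI_mono (@subset_refl _ _)
    (mulI_mono (NI j) (@subset_refl _ _))) _.
  rewrite -exprS.
  apply: subset_trans (mulI_mono (@subset_refl _ _) (c_surj n.+1 _)) _ => //.
  have -> : P j * ((Q + pid c) * I ^+ n.+1) =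
    pid c * (P j * I ^+ n.+1) + Q * (P j * I ^+ n.+1) by ring.
  apply: addI_mono => //; apply: mulI_mono => //.
  by rewrite -addSn addnC exprD; apply: mulI_mono.
have D_desc j : D j.+1 `<=` D j.
  move=> w [Iw Xw]; split => //.
  have [_ /mul_pidP[z Pz ->] [l Ll wE]] := XS _ _ Xw.
  suff: X j (w * c ^+ j) by [].
  rewrite -[w * c ^+ j](subrK z) addrC.
  apply: addI_in => //; apply: c_inj; first exact: leq_addr.
    apply: idealB.
      by rewrite -addSn exprD; apply: mulI_in => //; exact: expI_in.
    by rewrite -addSn addnC exprD; move: z Pz {wE}; apply: mulI_mono.
  have -> : c * (w * c ^+ j - z) = l; last by [].
  by rewrite mulrBr mulrCA -exprS -[w * _]wE; ring.
have [s Is] := ideal_fg R_noetherian (I ^+ n.+1).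
have [|rho [_ rho_lt]] := @ideal_rank _ m R_noetherian R_local (Q * I ^+ n) s.
  by rewrite -Is exprS mulrA; apply: mulI_mono.
(* As mI <= Q, the quotient I^(n+1)/Q I^n is a finite-dimensional k-space, and the rank cannot drop
   forever. *)
have [j Dj] : exists j, D j `<=` D j.+1.
  apply: contrapT => nD.
  have rhoS j : (rho (D j.+1) < rho (D j))%N.
    apply: rho_lt => // [w Qw|w [Iw _]|Dj]; last by apply: nD; exists j.
      split; first by rewrite exprS; move: w Qw; apply: mulI_mono.
      suff: X j.+1 (w * c ^+ j.+1) by [].
      apply: sub_addr; rewrite exprD mulrA; apply: mulI_in => //.
      exact: expI_in.
    by apply: sub_addr; rewrite -Is.
  have rho_bound j : (rho (D j) + j <= rho (D 0%N))%N.
    by elim: j => [|j IH]; [rewrite addn0|move: (rhoS j); lia].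
  by move: (rho_bound (rho (D 0%N)).+1); lia.
(* [D j <= D j.+1] transports back along c^j: c P_j I^(n+1) lies in P_j N_j I^(n+1) up to Q
   I^(n+j+1), and Q <= N_j. *)
have c_step : pid c * (P j * I ^+ n.+1) `<=` N j * I ^+ (n + j).+1.
  have QNj : Q * I ^+ (n + j).+1 `<=` N j * I ^+ (n + j).+1 by apply: mulI_mono.
  move=> _ /mul_pidP[z Pz ->].
  have Iz : (I ^+ (n + j).+1)%R z.
    by rewrite -addSn addnC exprD; move: z Pz; apply: mulI_mono.
  have [v] := pow_sub_c (j := j) Hn Iz.
  rewrite -pid_exp => /mul_pidP[w Iw ->] [l Ll zE].
  have [|_ Xw] := Dj w.
    split => //; suff: X j (w * c ^+ j) by [].
    have -> : w * c ^+ j = z - l by rewrite -zE; ring.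
    by apply: idealB; [exact: sub_addl|exact: sub_addr].
  have -> : c * z = w * c ^+ j.+1 + c * l by rewrite -zE exprS; ring.
  apply: idealD; last first.
    by apply: QNj; rewrite exprS mulrCA; apply: mulI_in.
  have : X j.+1 (w * c ^+ j.+1) by [].
  move: (_ * _); apply: addI_sub; last by rewrite addnS.
  rewrite PS mulrAC mulrC -addSn addnC exprD; apply: mulI_mono => //.
  exact: mulI_mono.
have [|q nq Hq] := @comaximal_prod N (N j) n j NI.
  by move=> i; apply: N_comax.
(* I^(q+j+2) is contained in Q I^(q+j+1) + c I^(q+j+1). The first term is absorbed by N_j;
   comaximality splits the second into c P_j I^(q+1), handled by [c_step], and c N_j I^(q+j). So N_j
   would reduce I. *)
apply: (N_nonred j); exists (q + j).+1.
apply: subset_trans (c_surj _ _) _; first by lia.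
rewrite mulrDl; apply: addI_sub; first exact: mulI_mono.
apply: subset_trans (mulI_mono (@subset_refl _ (pid c)) Hq) _.
rewrite mulrDr; apply: addI_sub; last first.
  rewrite mulrCA exprS; apply: mulI_mono => //; apply: mulI_mono => //.
  exact: pid_sub.
rewrite -/(P j) -(subnKC nq) -addSn exprD !mulrA -[pid c * _ * _]mulrA.
apply: subset_trans (mulI_mono c_step (@subset_refl _ _)) _.
rewrite -mulrA -exprD.
by have -> : ((n + j).+1 + (q - n) = (n + (q - n) + j).+1)%N by lia.
Qed.

End Multiplication.

Definition max_nonred I Q : set (ideal R) :=
  [set N : ideal R | [/\ Q `<=` N, N `<=` I, ~ pow_red I N &
    forall N' : ideal R, N `<=` N' -> N' `<=` I -> ~ pow_red I N' -> N' = N]].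

(** An infinite set would contain an injective sequence. If the sum of two terms did not reduce I,
    maximality would make both terms equal to that sum. *)
Lemma finite_max_nonred I Q c : mm * I `<=` Q -> Q `<=` I -> I c ->
  pow_red I (Q + pid c) -> finite_set (max_nonred I Q).
Proof.
move=> mIQ QI Ic Qc; apply: contrapT => /infiniteP.
move=> /pcard_leP[f].
have fP i : max_nonred I Q (f i) by apply: funS.
apply: (comaximal_nonred_absurd QI Ic Qc mIQ (N := f)) => [i|i|i|i j ij].
- by have [] := fP i.
- by have [] := fP i.
- by have [] := fP i.
apply: contrapT => nr.
have [_ fiI _ fi_max] := fP i; have [_ fjI _ fj_max] := fP j.
have Hi := fi_max _ (sub_addl _ (f j)) (addI_sub fiI fjI) nr.
have Hj := fj_max _ (sub_addr (f i) _) (addI_sub fiI fjI) nr.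
have : i = j by apply: 'inj_f; rewrite ?inE //; exact: etrans (esym Hi) Hj.
lia.
Qed.

Lemma ex_max_nonred I Q N : Q `<=` N -> N `<=` I -> ~ pow_red I N ->
  exists2 N', max_nonred I Q N' & N `<=` N'.
Proof.
move=> QN NI nr.
have [N' [[N'I nr'] NN' N'max]] := ideal_maximal R_noetherian
  (P := fun N' : ideal R => N' `<=` I /\ ~ pow_red I N') (conj NI nr).
exists N' => //; split => //; first exact: subset_trans NN'.
by move=> N'' *; apply: N'max.
Qed.

End NonReductions.

(** * Integral dependence and the condition on powers *)

Section Integral.
Variable R : comNzRingType.
Implicit Types (I J K : ideal R) (x y z : R) (s : seq R).

(** Beyond exponent q, factors I can be traded for factors K; p + 1 of them then yield a factor
    J. *)
Lemma pow_red_trans I K J : K `<=` I -> J `<=` K ->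
  pow_red K J -> pow_red I K -> pow_red I J.
Proof.
move=> KI JK [p Hp] [q Hq]; exists (p + q)%N.
have Ha a : I ^+ (a + q) `<=` K ^+ a * I ^+ q.
  elim: a => [|a IH]; first by rewrite expr0 mul1r.
  rewrite addSn !exprS; apply: subset_trans (mulI_mono (@subset_refl _ _) IH) _.
  by rewrite mulrCA -(exprS I) [K * _]mulrC -mulrA; apply: mulI_mono.
rewrite -addSn; apply: subset_trans (Ha _) _.
apply: subset_trans (mulI_mono Hp (@subset_refl _ _)) _.
by rewrite exprD -mulrA; do 2![apply: mulI_mono => //]; apply: expI_mono.
Qed.

(** The only term of the expanded power without a factor from K is x^(p+1). *)
Lemma pow_adjoin K x p :
  (K + pid x) ^+ p.+1 `<=` K * (K + pid x) ^+ p + pid x ^+ p.+1.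
Proof.
elim: p => [|p IH]; first by rewrite !expr1 expr0 mulr1.
rewrite exprS; apply: subset_trans (mulI_mono (@subset_refl _ _) IH) _.
rewrite mulrDr mulrCA -exprS mulrDl -exprS addrA.
apply: addI_sub; last exact: sub_addr.
apply: addI_sub; first exact: sub_addl.
apply: subset_trans (sub_addl _ _); apply: mulI_mono => //.
by apply: expI_mono; exact: sub_addr.
Qed.

(** In an integral equation of degree p + 1, the term c_i x^(p+1-i) lies in J^i K^(p+1-i) <= J
    K^p. *)
Lemma integral_pow J K x : J `<=` K -> K x -> integral_over J x ->
  exists p, (J * K ^+ p)%R (x ^+ p.+1).
Proof.
move=> JK Kx [[|p] [c [// _ Jc x0]]]; exists p.
have -> : x ^+ p.+1 = - \sum_(1 <= i < p.+2) c i * x ^+ (p.+1 - i).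
  by apply/eqP; rewrite -addr_eq0 x0.
apply: idealN; rewrite big_nat; apply: (big_ind (J * K ^+ p)%R).
- exact: ideal0.
- exact: idealD.
move=> [|i] /andP[// _ ip]; rewrite subSS.
have Ji : (J ^+ i.+1)%R (c i.+1) by rewrite -expI_eq; apply: Jc.
have Ki : (K ^+ (p - i))%R (x ^+ (p - i)) by exact: expI_in.
have : (J ^+ i.+1 * K ^+ (p - i))%R (c i.+1 * x ^+ (p - i)) by exact: mulI_in.
have -> : J * K ^+ p = J * K ^+ i * K ^+ (p - i).
  by rewrite -mulrA -exprD subnKC.
rewrite exprS; move: (c _ * _); do 2![apply: mulI_mono => //].
exact: expI_mono.
Qed.

Lemma pow_red_of_integral J s : (forall x, x \in s -> integral_over J x) ->
  pow_red (J + ispan s) J.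
Proof.
elim: s => [_|x s IH Hs].
  by exists 0%N; rewrite ispan_nil addr0 expr0 mulr1.
have Js : pow_red (J + ispan s) J.
  by apply: IH => y ys; apply: Hs; rewrite inE ys orbT.
have -> : J + ispan (x :: s) = (J + ispan s) + pid x.
  by rewrite ispan_cons addrCA addrC.
set K := J + ispan s in Js *.
have JK : J `<=` K by exact: sub_addl.
apply: (pow_red_trans (sub_addl _ _) JK Js).
have [|||p xp] := @integral_pow J (K + pid x) x.
- by apply: subset_trans JK _; exact: sub_addl.
- by apply: sub_addr; exact: pid_id.
- by apply: Hs; exact: mem_head.
exists p; apply: subset_trans (@pow_adjoin K x p) _; apply: addI_sub => //.
by rewrite -pid_exp; apply: pid_sub; move: xp; apply: mulI_mono.
Qed.

(* [P] is homogeneous of degree [n] when ['X] has degree 1 and the elements of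
   [J ^+ i] have degree [i]. *)
Definition homog J n (P : {poly R}) := forall k,
  ((k <= n)%N -> (J ^+ (n - k))%R P`_k) /\ ((n < k)%N -> P`_k = 0).

Lemma homogM J a b P Q : homog J a P -> homog J b Q -> homog J (a + b) (P * Q).
Proof.
move=> HP HQ k; split=> Hk.
  rewrite coefM; apply: (big_ind (J ^+ (a + b - k))%R) => [||i _].
  - exact: ideal0.
  - exact: idealD.
  have ik := ltn_ord i.
  have [ia|ia] := leqP i a; last by rewrite (HP i).2 // mul0r; exact: ideal0.
  have [ib|ib] := leqP (k - i) b; last first.
    by rewrite (HQ _).2 // mulr0; exact: ideal0.
  have -> : (a + b - k = (a - i) + (b - (k - i)))%N by lia.
  by rewrite exprD; apply: mulI_in; [apply: (HP i).1|apply: (HQ _).1].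
rewrite coefM big1 // => i _; have ik := ltn_ord i.
have [ia|ia] := leqP i a; last by rewrite (HP i).2 // mul0r.
by rewrite (HQ (k - i)%N).2 ?mulr0 //; lia.
Qed.

Lemma homogD J n P Q : homog J n P -> homog J n Q -> homog J n (P + Q).
Proof.
move=> HP HQ k; split=> Hk; rewrite coefD.
  by apply: idealD; [apply: (HP k).1|apply: (HQ k).1].
by rewrite (HP k).2 // (HQ k).2 // addr0.
Qed.

Lemma homogN J n P : homog J n P -> homog J n (- P).
Proof.
move=> HP k; split=> Hk; rewrite coefN.
  by apply: idealN; apply: (HP k).1.
by rewrite (HP k).2 // oppr0.
Qed.

Lemma homogXn J n : homog J n 'X^n.
Proof.
move=> k; split=> Hk; rewrite coefXn; last by rewrite gtn_eqF.
by have [->|_] := eqVneq k n; [rewrite subnn expr0|exact: ideal0].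
Qed.

(** Every entry of the characteristic matrix has degree 1, so each signed product in the determinant
    has degree n. *)
Lemma homog_char_poly J n (M : 'M[R]_n) :
  (forall i j, J (M i j)) -> homog J n (char_poly M).
Proof.
move=> JM; rewrite /char_poly /determinant.
apply: (big_ind (homog J n)) => [||f _].
- by move=> k; split=> _; rewrite coef0 //; exact: ideal0.
- by move=> P Q; apply: homogD.
- suff : homog J (\sum_(i < n) 1) (\prod_i char_poly_mx M i (f i)).
    rewrite sum1_card card_ord -signr_odd.
    by case: odd; rewrite ?expr1 ?expr0 ?mulN1r ?mul1r => // /homogN.
  elim/big_ind2: _ => [|P a Q b|i _]; first exact: (@homogXn J 0).
    by move=> HP HQ; apply: homogM.
  rewrite !mxE; apply: homogD; last first.
    apply: homogN => -[|k]; split=> // _; rewrite coefC.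
    - by rewrite subn0 expr1; exact: JM.
    - by [].
  case: (i == f i); first by rewrite mulr1n; exact: (@homogXn J 1).
  by rewrite mulr0n => k; split=> _; rewrite coef0 //; exact: ideal0.
Qed.

Lemma integral_of_monic J N (P : {poly R}) x : (0 < N)%N ->
  P \is monic -> size P = N.+1 -> homog J N P -> P.[x] = 0 -> integral_over J x.
Proof.
move=> N0 mP sP hP Px; exists N, (fun i => P`_(N - i)); split => // [i|].
  move=> /andP[i0 iN]; rewrite expI_eq.
  have [H _] := hP (N - i)%N; have := H (leq_subr _ _).
  by rewrite subKn.
rewrite -[RHS]Px horner_coef sP big_ord_recr /= addrC.
have -> : P`_N = 1 by move/monicP: mP; rewrite /lead_coef sP.
rewrite mul1r; congr (_ + _).
rewrite -(big_mkord xpredT (fun i => P`_i * x ^+ i)) big_add1 /=.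
rewrite [RHS]big_nat_rev /= !big_nat; apply: eq_bigr => i /andP[_ iN].
by rewrite ?add0n ?subn0.
Qed.

Lemma mul_ispan_coord J s y : (J * ispan s)%R y ->
  exists2 a : nat -> R, (forall j, J (a j)) & y = \sum_(j < size s) a j * s`_j.
Proof.
elim: s y => [|x s IH] y.
  rewrite ispan_nil mulr0 => ->; exists (fun=> 0).
    by move=> _; exact: ideal0.
  by rewrite big_ord0.
rewrite ispan_cons mulrDr mulrC => -[_ /mul_pidP[b Jb ->] [z Jz <-]].
have [a Ja ->] := IH z Jz.
exists (fun j => if j is j'.+1 then a j' else b) => [[|j]//|].
by rewrite big_ord_recl /= mulrC.
Qed.

(** The determinant trick on generators of I^p: x I^p <= J I^p gives a matrix M over J whose
    characteristic polynomial at x annihilates I^p, and in particular x^p. *)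
Lemma integral_of_pow_red I J x : noetherian R ->
  pow_red I J -> I x -> integral_over J x.
Proof.
move=> R_noetherian [p Hp] Ix.
have [s sE] := ideal_fg R_noetherian (I ^+ p); set n := size s.
have ex_a (i : 'I_n) : exists a : nat -> R,
    (forall j, J (a j)) /\ x * s`_i = \sum_(j < n) a j * s`_j.
  have [|a Ja aE] := @mul_ispan_coord J s (x * s`_i); last by exists a.
  rewrite -sE; apply: Hp; rewrite exprS; apply: mulI_in => //.
  by rewrite sE; apply: mem_ispan; exact: mem_nth.
have [a aP] := choice ex_a.
pose M := \matrix_(i, j < n) a i j.
pose g : 'cV[R]_n := \col_i s`_i.
pose A := map_mx (horner_eval x) (char_poly_mx M).
have Ag : A *m g = 0.
  apply/matrixP => i k; rewrite !mxE.
  under eq_bigr => j _ do rewrite !mxE /horner_eval hornerD hornerN hornerC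
    hornerMn hornerX mulrBl.
  rewrite sumrB -(aP i).2 (bigD1 i) //= eqxx mulr1n big1 ?addr0 ?subrr //.
  by move=> j ji; rewrite eq_sym (negbTE ji) mulr0n mul0r.
have detA : \det A = (char_poly M).[x] by rewrite det_map_mx.
have kill i : i \in s -> (char_poly M).[x] * i = 0.
  move=> /nthP-/(_ 0)[k ks <-].
  have : (\adj A *m A *m g) (Ordinal ks) 0 = 0 by rewrite -mulmxA Ag mulmx0 mxE.
  by rewrite mul_adj_mx mul_scalar_mx !mxE detA.
have killp : (char_poly M).[x] * x ^+ p = 0.
  have : ispan s `<=` colon 0 (char_poly M).[x].
    by apply: ispan_sub => i /kill Hi; rewrite /= mulrC.
  by rewrite -sE => /(_ _ (expI_in p Ix)); rewrite /= mulrC.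
(* The value of [char_poly M] at x need not vanish, but its product with x^p does. One more factor
   'X makes the degree visibly positive. *)
apply: (@integral_of_monic J (n + p.+1)%N (char_poly M * 'X^(p.+1)) x).
- by rewrite addnS.
- by rewrite monicMl ?monicXn ?char_poly_monic.
- by rewrite size_mulXn ?monic_neq0 ?char_poly_monic // size_char_poly; lia.
- apply: homogM; last exact: homogXn.
  by apply: homog_char_poly => i j; rewrite mxE; exact: (aP i).1.
- by rewrite hornerM hornerXn exprSr mulrA killp mul0r.
Qed.

Lemma is_reductionP I J : noetherian R ->
  is_reduction I J <-> J `<=` I /\ pow_red I J.
Proof.
move=> R_noetherian; split=> [[_ JI IJ]|[JI Jred]].
  split => //; have [s sE] := ideal_fg R_noetherian I.
  have IE : I = J + ispan s.
    by rewrite -sE; apply: ideal_eq; [exact: sub_addr|exact: addI_sub].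
  rewrite [X in pow_red X _]IE; apply: pow_red_of_integral => x xs; apply: IJ.
  by rewrite sE; exact: mem_ispan.
by split => //; [exact: idealP|move=> x Ix; exact: integral_of_pow_red Ix].
Qed.

End Integral.

(** * Exchange of generators and the size of minimal reductions *)

Section Exchange.
Variables (R : comNzRingType) (m : idealr R).
Hypotheses (R_noetherian : noetherian R) (R_local : is_local m).
Hypothesis k_infinite : infinite_set [set: {ideal_quot m}].
Variable I : ideal R.
Implicit Types (A B C J K N Q : ideal R) (x y z : R) (s t : seq R).
Let mm := of_idealr m.

(** No non-reducing ideal contains B, because B reduces I; finitely many of them can be avoided at
    once inside B. *)
Lemma pow_red_avoid Q c B : mm * I `<=` Q -> Q `<=` I -> I c ->
  pow_red I (Q + pid c) -> B `<=` I -> pow_red I B ->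
  exists2 b, B b & forall N, max_nonred I Q N -> ~ N b.
Proof.
move=> mIQ QI Ic Qc BI Bred.
have /finite_seqP[l lE] := finite_max_nonred R_noetherian R_local mIQ QI Ic Qc.
have [|b Bb bl] :=
  ideal_avoid R_noetherian R_local k_infinite (B := B) (l := l).
  move=> N Nl BN; have [_ _ nr _] : max_nonred I Q N by rewrite lE.
  exact: nr (pow_red_mono BN Bred).
by exists b => // N; rewrite lE => /bl.
Qed.

Lemma pow_red_of_avoid Q b : Q `<=` I -> I b ->
  (forall N, max_nonred I Q N -> ~ N b) -> pow_red I (Q + pid b).
Proof.
move=> QI Ib Hb; apply: contrapT => nr.
have [N maxN QbN] := ex_max_nonred R_noetherian (sub_addl _ (pid b))
  (addI_sub QI (pid_sub Ib)) nr.
by apply: (Hb N maxN); apply: QbN; apply: sub_addr; exact: pid_id.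
Qed.

Lemma pow_red_exchange A s : ispan s `<=` I -> pow_red I (ispan s + mm * I) ->
  A `<=` I -> pow_red I A ->
  exists t, [/\ ispan t `<=` A, size t = size s & pow_red I (ispan t)].
Proof.
move=> sI sred AI Ared.
(* [s'] holds the generators still to be exchanged and [t] those already taken from A. Each round
   puts the head of [s'] in the role of c; the summand mI is removed by Nakayama at the end. *)
suff H s' t : ispan s' `<=` I -> ispan t `<=` A ->
    pow_red I (ispan s' + ispan t + mm * I) ->
    exists t', [/\ ispan t' `<=` A, size t' = (size s' + size t)%N
      & pow_red I (ispan t' + mm * I)].
  have [||t [tA st tred]] := H s [::] sI.
  - by rewrite ispan_nil => _ ->; exact: ideal0.
  - by rewrite ispan_nil addr0.
  exists t; split => //; first by rewrite st addn0.
  exact: pow_red_mulm tred.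
elim: s' t => [|x s' IH] t s'I tA; first by rewrite ispan_nil add0r; exists t.
rewrite ispan_cons in s'I *; set Q := ispan s' + ispan t + mm * I.
have -> : pid x + ispan s' + ispan t + mm * I = Q + pid x by rewrite /Q; ring.
move=> Qx; have QI : Q `<=` I.
  apply: addI_sub; last exact: mulI_subr.
  apply: addI_sub; last exact: subset_trans AI.
  by apply: subset_trans s'I; exact: sub_addr.
have Ix : I x by apply: s'I; apply: sub_addl; exact: pid_id.
have [b Ab /(pow_red_of_avoid QI (AI _ Ab)) Qb] :=
  pow_red_avoid (sub_addr _ _) QI Ix Qx AI Ared.
have [|||t' [t'A st' t'pow_red]] := IH (b :: t).
- by apply: subset_trans s'I; exact: sub_addr.
- by rewrite ispan_cons; apply: addI_sub => //; exact: pid_sub.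
- rewrite ispan_cons.
  have -> // : ispan s' + (pid b + ispan t) + mm * I = Q + pid b.
  by rewrite /Q; ring.
by exists t'; split => //; rewrite st' /= addSnnS.
Qed.

(** Exchange moves [s] into A without changing its size, and minimality of A makes the result
    generate A. It remains to compare two generating sets of A, by rank modulo mA. *)
Lemma size_min_generating d (a : 'I_d -> R) A s :
  is_minimal_reduction I A -> is_minimal_generating a A ->
  ispan s `<=` I -> pow_red I (ispan s + mm * I) -> (d <= size s)%N.
Proof.
move=> [/(is_reductionP _ _ R_noetherian)[AI Ared] A_min] [a_gen a_irr] sI sred.
have [t [tA <- tred]] := pow_red_exchange sI sred AI Ared.
have AE : A = ispan t.
  have /A_min/(_ tA) tAE : is_reduction I (ispan t).
    by apply/is_reductionP => //; split => //; exact: subset_trans AI.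
  by apply: ideal_eq; rewrite tAE.
have [|rho [rho_le rho_lt]] :=
  @ideal_rank _ m R_noetherian R_local (mm * A) t; first by rewrite AE.
(* A flag whose rank grows at each of its d steps, so that d is at most the rank bound [size t]. *)
pose Y i := mm * A + gen (a @` [set j : 'I_d | (j < i)%N]).
have aA j : A (a j).
  by rewrite -a_gen; apply: (sub_gen (S := range a)); exists j.
have YA i : Y i `<=` A.
  by apply: addI_sub; [exact: mulI_subr|apply: gen_sub => _ [j _ <-]].
have rhoY i : (i <= d)%N -> (i <= rho (Y i))%N.
  elim: i => // i IH id; apply: leq_ltn_trans (IH (ltnW id)) _.
  apply: rho_lt; first exact: sub_addl.
  - apply: addI_mono => //; apply: gen_sub => _ [j ji <-]; apply: sub_gen.
    by exists j => //; exact: leqW.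
  - by apply: subset_trans (YA _) _; rewrite AE; exact: sub_addr.
  move=> YY; pose D := [set j | j != Ordinal id].
  have /a_irr DT : ideal_gen (a @` D) = A.
    suff -> : A = gen (a @` D) by [].
    apply: ideal_eq; last by apply: gen_sub => _ [j _ <-].
    apply: (nakayama_fg R_noetherian R_local).
    rewrite -{1}a_gen.
    apply: (@gen_sub _ _ (gen (a @` D) + mm * A)) => _ [j _ <-].
    have [->|jD] := eqVneq j (Ordinal id); last first.
      by apply: sub_addl; apply: sub_gen; exists j.
    have : Y i (a (Ordinal id)).
      by apply: YY; apply: sub_addr; apply: sub_gen; exists (Ordinal id) => /=.
    rewrite /Y addrC; apply: addI_mono => //; apply: gen_sub => _ [k ki <-].
    apply: sub_gen; exists k => //=; apply: contraTneq ki => ->.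
    by rewrite /= ltnn.
  have : D (Ordinal id) by rewrite DT.
  by rewrite /D /= eqxx.
exact: leq_trans (rhoY d (leqnn d)) (rho_le _).
Qed.

(** If a reduction K inside C were smaller, Nakayama would make its image in C/mC a proper subspace.
    Lifting a basis of that image gives fewer than [size s] elements that still generate a reduction
    modulo mI. *)
Lemma min_red_of_size s : ispan s `<=` I -> pow_red I (ispan s) ->
  (forall t, ispan t `<=` I -> pow_red I (ispan t + mm * I) ->
     (size s <= size t)%N) ->
  is_minimal_reduction I (ispan s).
Proof.
set C := ispan s => CI Cred s_min; split; first exact/is_reductionP.
move=> K' rK' K'C; have [iK' _ _] := rK'.
pose K := Ideal iK'; have [/= KI Kred] : K `<=` I /\ pow_red I K.
  by apply/is_reductionP.
suff CK : C `<=` K by apply/seteqP.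
apply: (nakayama_fg R_noetherian R_local); rewrite -/mm.
apply: contrapT => CK.
have [|rho [rho_le rho_lt]] :=
  @ideal_rank _ m R_noetherian R_local (mm * C) s => //.
(* The basis is grown by elements of K outside mC + [ispan t], each of which raises the rank; r
   counts the rounds. *)
have greedy r : exists t, [/\ ispan t `<=` K,
    (size t <= rho (mm * C + ispan t)%R)%N &
    K `<=` mm * C + ispan t \/ (r <= size t)%N].
  elim: r => [|r [t [tK st [Kt|rt]]]].
  - by exists [::]; split; [rewrite ispan_nil => _ ->; exact: ideal0| |right].
  - by exists t; split => //; left.
  have [Kt|Kt] := pselect (K `<=` mm * C + ispan t).
    by exists t; split => //; left.
  have [x [Kx tx]] : exists x, K x /\ ~ (mm * C + ispan t)%R x.
    apply: contrapT => nx; apply: Kt => x Kx.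
    by apply: contrapT => tx; apply: nx; exists x.
  exists (x :: t); rewrite ispan_cons; split => /=.
  - exact: (addI_sub (K := K) (pid_sub Kx) tK).
  - apply: leq_ltn_trans st _; apply: rho_lt.
    + exact: sub_addl.
    + by apply: addI_mono => //; exact: sub_addr.
    + apply: addI_mono => //; apply: subset_trans K'C.
      exact: (addI_sub (K := K) (pid_sub Kx) tK).
    + move=> H; apply: tx; apply: H; apply: sub_addr; apply: sub_addl.
      exact: pid_id.
  - by right.
(* The rank is at most [size s], so [(size s).+1] rounds cannot all add an element. *)
have [t [tK st [Kt|]]] := greedy (size s).+1; last first.
  by move: (rho_le (mm * C + ispan t)); lia.
have tC : mm * C + ispan t `<=` C.
  by apply: addI_sub; [exact: mulI_subr|exact: subset_trans K'C].
have : (rho (mm * C + ispan t)%R < rho C)%N.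
  apply: rho_lt => //; [exact: sub_addl|exact: sub_addr|].
  move=> Ct; apply: CK; apply: subset_trans Ct _.
  by rewrite addrC; apply: addI_mono.
have : (size s <= size t)%N.
  apply: s_min; first exact: subset_trans KI.
  apply: pow_red_mono Kred; apply: subset_trans Kt _; rewrite addrC.
  by apply: addI_mono => //; apply: mulI_mono.
by move: (rho_le C); lia.
Qed.

End Exchange.

(** * The exceptional ideals of the theorem *)

Theorem theorem3p1 (R : comNzRingType) (m : idealr R)
    (R_noetherian : noetherian R) (R_local : is_local m)
    (k_infinite : infinite_set [set: {ideal_quot m}])
    (I : set R) (I_ideal : is_ideal I) (I_proper : I <> setT)
    (d : nat) (I_spread : analytic_spread_eq m I d) (d_gt0 : (0 < d)%N)
    (A B : set R)
    (A_minred : is_minimal_reduction I A) (B_minred : is_minimal_reduction I B)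
    (a : 'I_d -> R) (a_gen : is_minimal_generating a A) :
  exists F : set (set R),
    [/\ finite_set F,
        forall J, F J -> is_ideal J /\ ideal_mul [set` m] B `<=` J,
        \bigcup_(J in F) J `<` B
      & forall b, B b ->
          (is_minimal_reduction I
             (ideal_gen ([set a i | i in [set i : 'I_d | (i < d.-1)%N]]
                         `|` [set b]))
           <-> ~ (\bigcup_(J in F) J) b)].

Proof.
have [[iA AI0 _] _] := A_minred; have [[iB BI0 _] _] := B_minred.
pose I' := Ideal I_ideal; pose A' := Ideal iA; pose B' := Ideal iB.
pose mm := of_idealr m.
have [AI Ared] : A' `<=` I' /\ pow_red I' A'.
  by apply/is_reductionP => //; case: A_minred.
have [BI Bred] : B' `<=` I' /\ pow_red I' B'.
  by apply/is_reductionP => //; case: B_minred.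
case: d d_gt0 {I_spread} a a_gen => // e _ a a_gen.
(* With d = e + 1, [s] lists all generators of A but the last, [a ord_max], which serves as c. *)
pose s := [seq a (widen_ord (leqnSn e) j) | j <- enum 'I_e].
have size_s : size s = e by rewrite size_map size_enum_ord.
have aA j : A (a j).
  by case: a_gen => <- _; apply: (sub_gen (S := range a)); exists j.
have sE : gen [set a i | i in [set i : 'I_e.+1 | (i < e)%N]] = ispan s.
  rewrite -ispanE; congr gen; apply/seteqP.
  split => [_ [i ie <-]|_ /mapP[j _ ->]].
    apply/mapP; exists (Ordinal ie); first by rewrite mem_enum.
    by congr a; apply: val_inj.
  by exists (widen_ord (leqnSn e) j) => //=; exact: ltn_ord.
have sI : ispan s `<=` I'.
  by apply: ispan_sub => _ /mapP[j _ ->]; apply: AI; exact: aA.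
pose Q := ispan s + mm * I'.
have QI : Q `<=` I' by apply: addI_sub => //; exact: mulI_subr.
have mIQ : mm * I' `<=` Q by exact: sub_addr.
have Ic : I' (a ord_max) by apply: AI; exact: aA.
have Qc : pow_red I' (Q + pid (a ord_max)).
  apply: pow_red_mono Ared; suff : A `<=` Q + pid (a ord_max) by [].
  case: a_gen => <- _.
  apply: (@gen_sub _ _ (Q + pid (a ord_max))) => _ [i _ <-].
  have [ie|] := ltnP i e.
    do 2!apply: sub_addl; apply: mem_ispan; apply/mapP.
    exists (Ordinal ie); first by rewrite mem_enum.
    by congr a; apply: val_inj.
  move=> ei; have -> : i = ord_max.
    by apply: val_inj => /=; have := ltn_ord i; lia.
  by apply: sub_addr; exact: pid_id.
have size_min t : ispan t `<=` I' -> pow_red I' (ispan t + mm * I') ->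
    (e.+1 <= size t)%N.
  exact: (size_min_generating (I := I') (A := A') R_noetherian R_local
    k_infinite A_minred a_gen).
have CE b : gen ([set a i | i in [set i : 'I_e.+1 | (i < e)%N]] `|` [set b])
    = ispan (b :: s).
  rewrite ispan_cons -sE; apply: ideal_eq.
    apply: gen_sub => x [ax|->]; first by apply: sub_addr; exact: sub_gen.
    by apply: sub_addl; exact: pid_id.
  apply: addI_sub; first by apply: pid_sub; apply: sub_gen; right.
  by apply: gen_sub => x ax; apply: sub_gen; left.
exists [set (cap N B' : set R) | N in max_nonred I' Q]; split.
- exact/finite_image/(finite_max_nonred R_noetherian R_local mIQ QI Ic Qc).
- move=> _ [N [QN NI _ _] <-]; split; first exact: idealP.
  have mB : mm * B' `<=` mm * I' by apply: mulI_mono.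
  move=> x mx; split; first by apply: QN; apply: mIQ; exact: mB.
  exact: (@mulI_subr _ mm B').
(* Properness of the union: B reduces I, so it has an element outside every N. *)
- split => [x [_ [N _ <-]] []//|H].
  have [b Bb bN] :=
    pow_red_avoid R_noetherian R_local k_infinite mIQ QI Ic Qc BI Bred.
  by have [_ [N /bN nb <-] []] := H b Bb.
move=> b Bb; have Ib := BI b Bb.
have bsI : ispan (b :: s) `<=` I'.
  by rewrite ispan_cons; apply: addI_sub => //; exact: pid_sub.
rewrite -[ideal_gen _]/(ideal_set (gen _)) CE; split.
  (* If b were in some N, then N would contain [b :: s] and reduce I. *)
  move=> [/(is_reductionP I' _ R_noetherian)[_ bred] _].
  move=> [_ [N [QN NI nr _] <-] [Nb _]].
  apply: nr; apply: pow_red_mono bred; rewrite ispan_cons.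
  apply: addI_sub; first exact: pid_sub.
  by apply: subset_trans QN; exact: sub_addl.
(* Avoidance makes [b :: s] generate a reduction; it has d elements, the least possible number by
   [size_min], so the reduction is minimal. *)
move=> nb; apply: (min_red_of_size (I := I') R_noetherian R_local) => //.
  apply: (pow_red_mulm R_noetherian R_local).
  have -> : ispan (b :: s) + of_idealr m * I' = Q + pid b.
    by rewrite ispan_cons /Q -/mm; ring.
  apply: (pow_red_of_avoid R_noetherian QI Ib) => N maxN Nb; apply: nb.
  by exists (cap N B') => //; exists N.
by move=> t tI tred; rewrite /= size_s; exact: size_min.
Qed.
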